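(* Let $\mathcal{L}$ be a unimodal signature and let $\mathsf{Fr}_{\mathcal{L}}$ be the class of all $\mathcal{L}$-unimodal frames. The following are equivalent: (i) $\mathsf{Fr}_{\mathcal{L}}$ is definable by quasiequations in the signature of bounded lattices together with $\mathcal{L}$; (ii) $\mathsf{Fr}_{\mathcal{L}}$ is definable by universal sentences in the signature of bounded lattices together with $\mathcal{L}$; (iii) $\mathsf{Fr}_{\mathcal{L}}$ is definable by equations in the signature of bi-Heyting algebras together with $\mathcal{L}$; (iv) $\mathsf{Fr}_{\mathcal{L}}$ is definable by universal sentences in the signature of bi-Heyting algebras together with $\mathcal{L}$; (v) $\mathcal{L}$ contains at most two modal symbols, $\mathcal{L}\neq\{\Box_{+},\Diamond_{+}\}$ and $\mathcal{L}\neq\{\Box_{-},\Diamond_{-}\}$.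
   Context: Modal symbols: $\Box_{+},\Box_{-},\Diamond_{+},\Diamond_{-}$; a unimodal signature $\mathcal{L}$ is a subset of these. For relations $S,T$, $x\,(S\circ T)\,z$ iff $xSy$ and $yTz$ for some $y$. On a poset $(W,\leq)$, $R\subseteq W\times W$ is a $\Box_{+}$-relation if ${\leq}\circ R\circ{\leq}\subseteq R$, a $\Box_{-}$-relation if ${\leq}\circ R\circ{\geq}\subseteq R$, a $\Diamond_{+}$-relation if ${\geq}\circ R\circ{\geq}\subseteq R$, a $\Diamond_{-}$-relation if ${\geq}\circ R\circ{\leq}\subseteq R$; for any $R$, $\Box_{+}[R]={\leq}\circ R\circ{\leq}$, $\Box_{-}[R]={\leq}\circ R\circ{\geq}$, $\Diamond_{+}[R]={\geq}\circ R\circ{\geq}$, $\Diamond_{-}[R]={\geq}\circ R\circ{\leq}$. An $\mathcal{L}$-modal frame $\mathcal{F}$ is a poset $(W,\leq)$ with a $\Delta_\alpha$-relation $R^{\Delta}_{\alpha}$ for each $\Delta_\alpha\in\mathcal{L}$; it is $\mathcal{L}$-unimodal if some relation $R$ satisfies $R^{\Delta}_{\alpha}=\Delta_\alpha[R]$ for all $\Delta_\alpha\in\mathcal{L}$. Its complex algebra $\mathcal{F}^{+}$ is the bounded lattice of upsets of $(W,\leq)$ (meet $\cap$, join $\cup$, top $W$, bottom $\emptyset$) with Heyting implication $a\rightarrow b=\{u:\forall v\geq u\,(v\in a\Rightarrow v\in b)\}$, co-implication $a-b=\{u:\exists v\leq u,\ v\in a,\ v\notin b\}$, and operators $\Box_{+}a=\{u:\forall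 v\,(uR^{\Box}_{+}v\Rightarrow v\in a)\}$, $\Box_{-}a=\{u:\forall v\,(uR^{\Box}_{-}v\Rightarrow v\notin a)\}$, $\Diamond_{+}a=\{u:\exists v\in a,\ uR^{\Diamond}_{+}v\}$, $\Diamond_{-}a=\{u:\exists v\notin a,\ uR^{\Diamond}_{-}v\}$. A class $\mathsf{K}$ of $\mathcal{L}$-modal frames is definable by a set of sentences (in a given signature) if for every $\mathcal{L}$-modal frame $\mathcal{F}$: $\mathcal{F}\in\mathsf{K}$ iff $\mathcal{F}^{+}$ satisfies all these sentences. *)

(* Defs.v *)
From HB Require Import structures.
From Corelib Require Relation_Definitions.
From mathcomp Require Import all_boot.
From mathcomp Require Import boolp classical_sets.

Set Implicit Arguments.
Unset Strict Implicit.
Unset Printing Implicit Defensive.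

Local Open Scope classical_set_scope.

Inductive modal_symbol : Type := BoxP | BoxM | DiamP | DiamM.

Definition modal_symbol_code (d : modal_symbol) : bool * bool :=
  match d with
  | BoxP => (true, true)
  | BoxM => (true, false)
  | DiamP => (false, true)
  | DiamM => (false, false)
  end.

Definition modal_symbol_decode (c : bool * bool) : modal_symbol :=
  match c with
  | (true, true) => BoxP
  | (true, false) => BoxM
  | (false, true) => DiamP
  | (false, false) => DiamM
  end.

Lemma modal_symbol_codeK : cancel modal_symbol_code modal_symbol_decode.
Proof. by case. Qed.

HB.instance Definition _ := Finite.copy modal_symbol (can_type modal_symbol_codeK).

Definition symbol_in (L : {set modal_symbol}) : Type := {d : modal_symbol | d \in L}.

Definition relation (W : Type) : Type := W -> W -> Prop.

Definition rcomp (W : Type) (S T : relation W) : relation W :=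
  fun x z => exists y, S x y /\ T y z.

Definition converse (W : Type) (S : relation W) : relation W := fun x y => S y x.

(* [modal_closure le d R] is d[R] over the order [le]. *)
Definition modal_closure (W : Type) (le : relation W) (d : modal_symbol)
    (R : relation W) : relation W :=
  let ge := converse le in
  match d with
  | BoxP => rcomp (rcomp le R) le
  | BoxM => rcomp (rcomp le R) ge
  | DiamP => rcomp (rcomp ge R) ge
  | DiamM => rcomp (rcomp ge R) le
  end.

Definition is_modal_relation (W : Type) (le : relation W) (d : modal_symbol)
    (R : relation W) : Prop :=
  forall x y, modal_closure le d R x y -> R x y.

Record modal_frame (L : {set modal_symbol}) : Type := ModalFrame {
  world :> Type;
  le : relation world;
  le_order : Relation_Definitions.order world le;
  acc : symbol_in L -> relation world;
  acc_modal : forall d : symbol_in L, is_modal_relation le (val d) (acc d)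
}.

Definition unimodal (L : {set modal_symbol}) (F : modal_frame L) : Prop :=
  exists R : relation F,
    forall d : symbol_in L, acc d = modal_closure (@le L F) (val d) R.

(* Algebras in the signature of bi-Heyting algebras together with L, with no
   axioms imposed. *)
Record algebra (L : {set modal_symbol}) : Type := Algebra {
  carrier :> Type;
  meet : carrier -> carrier -> carrier;
  join : carrier -> carrier -> carrier;
  top : carrier;
  bot : carrier;
  imp : carrier -> carrier -> carrier;
  coimp : carrier -> carrier -> carrier;
  modal : symbol_in L -> carrier -> carrier
}.

Section ComplexAlgebra.
Variables (L : {set modal_symbol}) (F : modal_frame L).
Implicit Types (a b : set F) (d : symbol_in L).

Definition is_upset a : Prop := forall u v, le u v -> a u -> a v.

Definition upset : Type := {a : set F | is_upset a}.

Definition imp_set a b : set F := [set u | forall v, le u v -> a v -> b v].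

Definition coimp_set a b : set F := [set u | exists v, [/\ le v u, a v & ~ b v]].

Definition modal_set d a : set F :=
  match val d with
  | BoxP => [set u | forall v, acc d u v -> a v]
  | BoxM => [set u | forall v, acc d u v -> ~ a v]
  | DiamP => [set u | exists v, a v /\ acc d u v]
  | DiamM => [set u | exists v, ~ a v /\ acc d u v]
  end.

Lemma is_upsetI a b : is_upset a -> is_upset b -> is_upset (a `&` b).
Proof. by move=> ha hb u v uv [au bu]; split; [exact: ha uv au|exact: hb uv bu]. Qed.

Lemma is_upsetU a b : is_upset a -> is_upset b -> is_upset (a `|` b).
Proof.
by move=> ha hb u v uv [au|bu]; [left; exact: ha uv au|right; exact: hb uv bu].
Qed.

Lemma is_upsetT : is_upset setT.
Proof. by []. Qed.

Lemma is_upset0 : is_upset set0.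
Proof. by []. Qed.

Lemma is_upset_imp a b : is_upset (imp_set a b).
Proof.
case: (le_order F) => _ letrans _ u v uv hu w vw; apply: hu.
exact: letrans uv vw.
Qed.

Lemma is_upset_coimp a b : is_upset (coimp_set a b).
Proof.
case: (le_order F) => _ letrans _ u v uv [w [wu aw nbw]].
by exists w; split=> //; exact: letrans wu uv.
Qed.

Lemma is_upset_modal d a : is_upset (modal_set d a).
Proof.
case: (le_order F) => lerefl _ _ u v uv.
have := @acc_modal L F d; rewrite /modal_set /is_modal_relation.
case: (val d) => /= hd.
- move=> hu w vw; apply: hu; apply: hd; exists w; split; last exact: lerefl.
  by exists v.
- move=> hu w vw; apply: hu; apply: hd; exists w; split; last exact: lerefl.
  by exists v.
- move=> [w [aw uw]]; exists w; split=> //; apply: hd; exists w.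
  by split; [exists u|exact: lerefl].
- move=> [w [aw uw]]; exists w; split=> //; apply: hd; exists w.
  by split; [exists u|exact: lerefl].
Qed.

Definition complex_algebra : algebra L :=
  @Algebra L upset
    (fun a b : upset => exist _ (sval a `&` sval b) (is_upsetI (svalP a) (svalP b)))
    (fun a b : upset => exist _ (sval a `|` sval b) (is_upsetU (svalP a) (svalP b)))
    (exist _ setT is_upsetT)
    (exist _ set0 is_upset0)
    (fun a b : upset => exist _ (imp_set (sval a) (sval b)) (@is_upset_imp (sval a) (sval b)))
    (fun a b : upset =>
       exist _ (coimp_set (sval a) (sval b)) (@is_upset_coimp (sval a) (sval b)))
    (fun d (a : upset) => exist _ (modal_set d (sval a)) (@is_upset_modal d (sval a))).

End ComplexAlgebra.

Inductive term (L : {set modal_symbol}) : Type :=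
  | TVar of nat
  | TMeet of term L & term L
  | TJoin of term L & term L
  | TTop
  | TBot
  | TImp of term L & term L
  | TCoimp of term L & term L
  | TModal of symbol_in L & term L.

Fixpoint lattice_term (L : {set modal_symbol}) (t : term L) : bool :=
  match t with
  | TVar _ | TTop | TBot => true
  | TMeet s t | TJoin s t => lattice_term s && lattice_term t
  | TImp _ _ | TCoimp _ _ => false
  | TModal _ t => lattice_term t
  end.

Fixpoint eval (L : {set modal_symbol}) (A : algebra L) (e : nat -> A)
    (t : term L) : A :=
  match t with
  | TVar n => e n
  | TMeet s t => meet (eval e s) (eval e t)
  | TJoin s t => join (eval e s) (eval e t)
  | TTop => top A
  | TBot => bot A
  | TImp s t => imp (eval e s) (eval e t)
  | TCoimp s t => coimp (eval e s) (eval e t)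
  | TModal d t => modal d (eval e t)
  end.

(* A quantifier-free formula stands for the universal sentence that is its
   universal closure. *)
Inductive qf_formula (L : {set modal_symbol}) : Type :=
  | FEq of term L & term L
  | FTrue
  | FNot of qf_formula L
  | FAnd of qf_formula L & qf_formula L
  | FOr of qf_formula L & qf_formula L
  | FImp of qf_formula L & qf_formula L.

Arguments FTrue {L}.

Fixpoint lattice_formula (L : {set modal_symbol}) (f : qf_formula L) : bool :=
  match f with
  | FEq s t => lattice_term s && lattice_term t
  | FTrue => true
  | FNot f => lattice_formula f
  | FAnd f g | FOr f g | FImp f g => lattice_formula f && lattice_formula g
  end.

Fixpoint holds (L : {set modal_symbol}) (A : algebra L) (e : nat -> A)
    (f : qf_formula L) : Prop :=
  match f with
  | FEq s t => eval e s = eval e t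
  | FTrue => True
  | FNot f => ~ holds e f
  | FAnd f g => holds e f /\ holds e g
  | FOr f g => holds e f \/ holds e g
  | FImp f g => holds e f -> holds e g
  end.

Definition satisfies (L : {set modal_symbol}) (A : algebra L)
    (f : qf_formula L) : Prop :=
  forall e : nat -> A, holds e f.

Definition biheyting_universal (L : {set modal_symbol}) : set (qf_formula L) := setT.

Definition lattice_universal (L : {set modal_symbol}) : set (qf_formula L) :=
  [set f | lattice_formula f].

Definition biheyting_equation (L : {set modal_symbol}) : set (qf_formula L) :=
  [set f | exists s t : term L, f = FEq s t].

Definition quasiequation (L : {set modal_symbol}) (ps : seq (term L * term L))
    (s t : term L) : qf_formula L :=
  FImp (foldr (fun p f => FAnd (FEq p.1 p.2) f) FTrue ps) (FEq s t).

Definition lattice_quasiequation (L : {set modal_symbol}) : set (qf_formula L) :=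
  [set f | lattice_formula f /\
     exists (ps : seq (term L * term L)) (s t : term L), f = quasiequation ps s t].

Definition definable_by (L : {set modal_symbol}) (K : modal_frame L -> Prop)
    (C : set (qf_formula L)) : Prop :=
  exists2 G : set (qf_formula L), G `<=` C &
    forall F : modal_frame L,
      K F <-> forall f, G f -> satisfies (complex_algebra F) f.

(* Main.v *)
Require Import Defs.
From Corelib Require Relation_Definitions.
From mathcomp Require Import all_boot all_order all_algebra.
From mathcomp Require Import boolp classical_sets lra.

(** Call the subscript + or - of a modal symbol its sign.  Condition (v) says that
    the symbols of [L] have distinct signs.

    If the signs are distinct, [L] has at most two symbols [d], [d'], and the frame
    is unimodal iff each relation is recovered from the intersection of the two:
    every pair in [acc d] lies in the closure of [acc d /\ acc d'].  When the signs
    differ, the two relations are closed in the same direction in one of their two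
    arguments, so the search for a pair in the intersection moves only the other
    argument, and this is expressible by an inequality between terms.

    If two symbols of [L], necessarily a box and a diamond, share the sign [s], take
    two lines [rat], the second one reversed when [s] is -, and relate the
    nondyadic points of the first line to their copies on the second.  This gives a
    unimodal frame, in which the box relates [u] to [v] iff some nondyadic [r] has
    [u <= r <= v], and the diamond iff some nondyadic [r] has [v <= r <= u].  On
    the subframe of dyadic points these become [u < v] and [v < u], which are
    disjoint, so the subframe is not unimodal; yet its complex algebra embeds in
    that of the whole frame: extending a set of dyadics across the nondyadic cuts
    commutes with all operations, because a nondyadic point is related to its copy. *)

Set Implicit Arguments.
Unset Strict Implicit.
Unset Printing Implicit Defensive.

Import Order.TTheory GRing.Theory Num.Theory.
Local Open Scope classical_set_scope.

(** * Signs and kinds of modal symbols *)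

Definition is_box (d : modal_symbol) : bool := (modal_symbol_code d).1.
Definition sign (d : modal_symbol) : bool := (modal_symbol_code d).2.

Lemma sign_injectiveP (L : {set modal_symbol}) :
  [/\ #|L| <= 2, L <> [set BoxP; DiamP]%SET & L <> [set BoxM; DiamM]%SET] <->
  {in L &, injective sign}.
Proof.
split=> [[cL nP nM]|inj]; last first.
  split.
  - by rewrite -(card_in_imset inj) -card_bool max_card.
  - move=> LE; have: BoxP = DiamP by apply: inj; rewrite ?LE ?inE ?eqxx.
    by [].
  - move=> LE; have: BoxM = DiamM by apply: inj; rewrite ?LE ?inE ?eqxx.
    by [].
(* With at most two elements in [L], any two distinct members exhaust it, and the pairs of equal
   sign are the two excluded ones. *)
have pairE a b : a != b -> a \in L -> b \in L -> L = [set a; b]%SET.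
  move=> ab aL bL; apply/esym/eqP; rewrite eqEcard cards2 ab cL andbT.
  by apply/fintype.subsetP => x /[!inE] /orP[] /eqP ->.
by move=> [] [] // dL d'L _; exfalso;
  first [by apply: nP; apply: pairE|by apply: nM; apply: pairE].
Qed.

(** The kind (box or diamond) alone fixes the direction of closure in the first argument; agreement
    of kind and sign fixes it in the second. *)
Lemma modal_closureP (W : Type) (le : relation W) d (R : relation W) x y :
  modal_closure le d R x y <->
  exists x' y', [/\ if is_box d then le x x' else le x' x, R x' y' &
                    if is_box d == sign d then le y' y else le y y'].
Proof.
case: d; (split=> [[y' [[x' [? ?]] ?]]|[x' [y' [? ? ?]]]];
  [by exists x', y'|by exists y'; split=> //; exists x']).
Qed.

(** * Interpolation in a frame *)

Section Frames.
Variables (L : {set modal_symbol}) (F : modal_frame L).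
Implicit Types (d : symbol_in L) (x y : F).

Lemma frame_refl x : le x x.
Proof. by case: (le_order F). Qed.

Lemma frame_trans y x z : le x y -> le y z -> le x z.
Proof. by case: (le_order F) => _ tr _; apply: tr. Qed.

Lemma sub_modal_closure (d : modal_symbol) (R : relation F) x y :
  R x y -> modal_closure (@le L F) d R x y.
Proof.
move=> Rxy; apply/modal_closureP; exists x, y.
by split=> //; case: ifP => _; apply: frame_refl.
Qed.

Lemma accP d x y :
  (exists x' y', [/\ if is_box (val d) then le x x' else le x' x, acc d x' y' &
                if is_box (val d) == sign (val d) then le y' y else le y y']) ->
  acc d x y.
Proof. by move=> h; apply: acc_modal; apply/modal_closureP. Qed.

Definition interpolates d d' : Prop := forall x y,
  acc d x y ->
  modal_closure (@le L F) (val d) (fun x' y' => acc d x' y' /\ acc d' x' y') x y.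

(** A witness of unimodality lies inside every [acc d], so the pair that generates [x], [y] lies in
    the intersection. *)
Lemma unimodal_interpolates d d' : unimodal F -> interpolates d d'.
Proof.
case=> R RE x y; rewrite {1}RE => /modal_closureP[x' [y' [h1 Rxy h2]]].
apply/modal_closureP; exists x', y'; split=> //.
by rewrite !RE; split; apply: sub_modal_closure.
Qed.

(* The intersection of all the relations is the only candidate worth testing,
   since every witness of unimodality is contained in it. *)
Lemma interpolates_unimodal : {in L &, injective sign} ->
  (forall d d', sign (val d) != sign (val d') -> interpolates d d') -> unimodal F.
Proof.
move=> inj hF; exists (fun x y => forall d, acc d x y) => d.
apply/funext => x; apply/funext => y; apply/propext; split; last first.
  move=> /modal_closureP[x' [y' [h1 Rxy h2]]].
  by apply: accP; exists x', y'; split.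
move=> dxy; case: (pselect (exists d', sign (val d) != sign (val d'))) => [[d' dd']|nd'].
  have /modal_closureP[x' [y' [h1 [a1 a2] h2]]] := hF d d' dd' x y dxy.
  apply/modal_closureP; exists x', y'; split=> // d''.
  (* Each sign occurs only once, so [d''] is [d] or [d']. *)
  have [dd''|dd''] := eqVneq (sign (val d)) (sign (val d'')).
    by have <- : d = d'' by apply/val_inj/inj => //; apply: valP.
  suff <- : d' = d'' by [].
  apply/val_inj/inj; [exact: valP|exact: valP|].
  by case: (sign _) (sign _) (sign _) dd' dd'' => [] [] [].
apply: sub_modal_closure => d'.
have <- : d = d' => //; apply/val_inj/inj; [exact: valP|exact: valP|].
by apply/eqP/negPn/negP => dd'; apply: nd'; exists d'.
Qed.

Lemma upset_inj (a b : upset F) : sval a = sval b -> a = b.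
Proof. by case: a b => [a ha] [b hb] /= ab; apply: eq_exist. Qed.

Definition tle (s t : term L) : term L * term L := (TMeet s t, s).

Lemma holds_tle (e : nat -> complex_algebra F) s t :
  holds e (FEq (tle s t).1 (tle s t).2) <-> sval (eval e s) `<=` sval (eval e t).
Proof.
split=> /= [/(congr1 sval) /= h x|h]; first by rewrite -h => -[].
apply: upset_inj => /=; apply/seteqP; split=> x; [by case|].
by move=> sx; split=> //; apply: h.
Qed.

Definition above_of x : upset F.
Proof. by exists [set v | le x v] => u v uv xu; apply: frame_trans uv. Defined.

Definition not_below_of x : upset F.
Proof. by exists [set v | ~ le v x] => u v uv nu vx; apply: nu; apply: frame_trans vx. Defined.

Lemma is_upset_acc d x :
  is_upset [set v | if is_box (val d) == sign (val d) then acc d x v else ~ acc d x v].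
Proof.
case Ed: (is_box (val d) == sign (val d)) => u v uv /= h; last move=> dxv; try apply: h.
  apply: accP; exists x, u; rewrite Ed; split=> //.
  by case: ifP => _; apply: frame_refl.
apply: accP; exists x, v; rewrite Ed; split=> //.
by case: ifP => _; apply: frame_refl.
Qed.

Definition acc_upset d x : upset F := exist _ _ (is_upset_acc (d := d) (x := x)).

Definition valuation (a b : upset F) (n : nat) : complex_algebra F :=
  if n is 0 then a else b.

End Frames.

(** * Formulas expressing interpolation *)

Section InterpolationFormulas.
Variable L : {set modal_symbol}.
Implicit Types d : symbol_in L.

Notation b := (TVar L 0).
Notation c := (TVar L 1).

(** The pair stands for an inequality. For equal kinds only the second argument moves, and [c]
    splits the successors according to [d']. For different kinds only the first moves, and
    (co-)implication ranges over the points above or below. Pairs of equal sign get a trivial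
    default. *)
Definition interpolation_ineq d d' : term L * term L :=
  match val d, val d' with
  | BoxP, BoxM => (TMeet (TModal d (TJoin b c)) (TModal d' c), TModal d b)
  | BoxM, BoxP => (TMeet (TModal d (TMeet b c)) (TModal d' c), TModal d b)
  | DiamP, DiamM => (TModal d b, TJoin (TModal d (TMeet b c)) (TModal d' c))
  | DiamM, DiamP => (TModal d b, TJoin (TModal d (TJoin b c)) (TModal d' c))
  | BoxP, DiamM | BoxM, DiamP =>
      (TImp (TModal d' b) (TModal d b), TModal d b)
  | DiamP, BoxM | DiamM, BoxP =>
      (TModal d b, TCoimp (TModal d b) (TModal d' b))
  | _, _ => (TTop L, TTop L)
  end.

Definition interpolation_eqn d d' : qf_formula L :=
  let p := tle (interpolation_ineq d d').1 (interpolation_ineq d d').2 in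
  FEq p.1 p.2.

Definition quasi_ineq (ps : seq (term L * term L)) (p : term L * term L) :=
  quasiequation [seq tle q.1 q.2 | q <- ps] (tle p.1 p.2).1 (tle p.1 p.2).2.

(* For a box and a diamond, (co-)implication is eliminated from
   [interpolation_ineq] by residuation. *)
Definition interpolation_quasi d d' : qf_formula L :=
  match is_box (val d), is_box (val d') with
  | true, false =>
      quasi_ineq [:: (TMeet c (TModal d' b), TModal d b)] (c, TModal d b)
  | false, true =>
      quasi_ineq [:: (TModal d b, TJoin (TModal d' b) c)] (TModal d b, c)
  | _, _ => quasi_ineq [::] (interpolation_ineq d d')
  end.

Lemma lattice_interpolation_quasi d d' : lattice_formula (interpolation_quasi d d').
Proof. by case: d d' => [[] p] [[] p']. Qed.

Lemma lattice_quasiequation_interpolation d d' :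
  lattice_quasiequation (interpolation_quasi d d').
Proof.
split; first exact: lattice_interpolation_quasi.
rewrite /interpolation_quasi.
by case: ifP => _; case: ifP => _; rewrite /quasi_ineq;
  match goal with |- exists _ _ _, quasiequation ?ps ?s ?t = _ => exists ps, s, t end.
Qed.

Variable F : modal_frame L.
Implicit Types x y : F.

(** Equal kinds close both relations in the same direction in the first argument, so [x'] can be
    moved back to [x]. *)
Lemma interpolates_same_kind d d' x y : is_box (val d) = is_box (val d') ->
  interpolates F d d' -> acc d x y ->
  exists2 y', acc d x y' /\ acc d' x y' &
    if is_box (val d) == sign (val d) then le y' y else le y y'.
Proof.
move=> dd' hF /hF/modal_closureP[x' [y' [xx' [h1 h2] yy']]]; exists y' => //.
by split; apply: accP; exists x', y'; rewrite -?dd'; split=> //;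
  case: ifP => _; apply: frame_refl.
Qed.

Lemma interpolates_other_kind d d' x y : is_box (val d) != is_box (val d') ->
  sign (val d) != sign (val d') -> interpolates F d d' -> acc d x y ->
  exists2 x', acc d x' y /\ acc d' x' y &
    if is_box (val d) then le x x' else le x' x.
Proof.
move=> bdd' sdd' hF /hF/modal_closureP[x' [y' [xx' [h1 h2] yy']]]; exists x' => //.
(* As kind and sign both differ, the relations are closed in the same direction in the second
   argument, and [y'] can be moved to [y]. *)
have E : (is_box (val d) == sign (val d)) = (is_box (val d') == sign (val d')).
  by case: (is_box _) (sign _) (is_box _) (sign _) bdd' sdd' => [] [] [] [].
by split; apply: accP; exists x', y'; rewrite -?E; split=> //;
  case: ifP => _; apply: frame_refl.
Qed.

(** For equal kinds the interpolating successor [w] of [u] is tested against [c]; for different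
    kinds the interpolating [w], above or below [u], is the instance to which the (co-)implication
    is applied. *)
Lemma interpolates_eqn d d' : sign (val d) != sign (val d') ->
  interpolates F d d' -> satisfies (complex_algebra F) (interpolation_eqn d d').
Proof.
move=> dd' hF e; apply/holds_tle => u.
have uA := svalP (e 0); have uC := svalP (e 1).
have [Eb|Eb] := eqVneq (is_box (val d)) (is_box (val d')).
  have := fun x y => interpolates_same_kind (x := x) (y := y) Eb hF.
  move: dd' Eb {hF}; case: d d' => [[] p] [[] p'] //= _ _ hF;
    rewrite /modal_set /=.
  - move=> [h1 h2] v /hF[w [uw u'w] wv].
    by case: (h1 w uw) => [|/(h2 _ u'w)//]; apply: uA.
  - move=> [h1 h2] v /hF[w [uw u'w] vw] Av.
    by apply: (h1 w uw); split; [apply: uA Av|apply: h2].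
  - move=> [v [Av /hF[w [h1 h2] vw]]].
    have Aw := uA _ _ vw Av; have [Cw|Cw] := pselect (sval (e 1) w).
      by left; exists w.
    by right; exists w.
  - move=> [v [Av /hF[w [h1 h2] vw]]].
    have Aw : ~ sval (e 0) w by move=> /(uA _ _ vw).
    have [Cw|Cw] := pselect (sval (e 1) w); first by right; exists w.
    by left; exists w; split=> // -[].
have := fun x y => interpolates_other_kind (x := x) (y := y) Eb dd' hF.
move: dd' Eb {hF}; case: d d' => [[] p] [[] p'] //= _ _ hF;
  rewrite /modal_set /=.
- move=> h v /hF[w [wv w'v] uw]; have [//|nAv] := pselect (sval (e 0) v).
  by apply: (h w uw _ v wv); exists v.
- move=> h v /hF[w [wv w'v] uw] Av.
  by apply: (h w uw _ v wv Av); exists v.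
- move=> [v [Av /hF[w [wv w'v] wu]]]; exists w; split=> //; first by exists v.
  by move=> /(_ v w'v).
- move=> [v [Av /hF[w [wv w'v] wu]]]; exists w; split=> //; first by exists v.
  by move=> /(_ v w'v).
Qed.

Local Arguments holds : simpl never.

Lemma holds_quasi_ineq0 (e : nat -> complex_algebra F) p :
  holds e (quasi_ineq [::] p) <-> sval (eval e p.1) `<=` sval (eval e p.2).
Proof. by split=> [h|/holds_tle h _]; [apply/holds_tle; exact: (h I)|]. Qed.

Lemma holds_quasi_ineq1 (e : nat -> complex_algebra F) q p :
  holds e (quasi_ineq [:: q] p) <->
  (sval (eval e q.1) `<=` sval (eval e q.2) ->
   sval (eval e p.1) `<=` sval (eval e p.2)).
Proof.
split=> [h q12|h [/holds_tle q12 _]]; apply/holds_tle; last exact: h.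
by apply: (h (conj _ I)); apply/holds_tle.
Qed.

(** Residuation: since [c] is an upset, the premise puts [c] below the implication, or the
    co-implication below [c]. *)
Lemma eqn_quasi d d' : sign (val d) != sign (val d') ->
  satisfies (complex_algebra F) (interpolation_eqn d d') ->
  satisfies (complex_algebra F) (interpolation_quasi d d').
Proof.
move=> dd' h e; have /holds_tle {h} := h e; have uC := svalP (e 1).
rewrite /interpolation_quasi.
by case: d d' dd' => [[] p] [[] p'] //= _ h;
  (try by apply/holds_quasi_ineq0);
  apply/holds_quasi_ineq1 => hc u /= hu;
  [apply: h => v uv hv; apply: hc; split=> //; apply: uC hu
  |apply: h => v uv hv; apply: hc; split=> //; apply: uC hu
  |have [v [vu hv nv]] := h u hu; apply: uC vu _; case: (hc v hv)
  |have [v [vu hv nv]] := h u hu; apply: uC vu _; case: (hc v hv)].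
Qed.

Lemma quasi_interpolates d d' : sign (val d) != sign (val d') ->
  satisfies (complex_algebra F) (interpolation_quasi d d') -> interpolates F d d'.
Proof.
move=> dd' h x y dxy; apply: contrapT => ncl.
have {}ncl x' y' : acc d x' y' -> acc d' x' y' ->
    (if is_box (val d) then le x x' else le x' x) ->
    (if is_box (val d) == sign (val d) then le y' y else le y y') -> False.
  by move=> h1 h2 h3 h4; apply: ncl; apply/modal_closureP; exists x', y'.
have xx := frame_refl x; have yy := frame_refl y.
(* [B] is chosen so that the value of [TModal d b] at [x] decides [acc d x y]. [C] encodes the
   [d']-successors of [x] for equal kinds; otherwise it, or its complement for a diamond [d], is the
   range of the candidates [x']. *)
pose B := if is_box (val d) == sign (val d) then not_below_of y else above_of y.
pose C := if is_box (val d) == is_box (val d') then acc_upset d' x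
  else if is_box (val d) then above_of x else not_below_of x.
have := h (valuation B C); rewrite {}/B {}/C {h} /interpolation_quasi.
have accr (d0 : symbol_in L) (u v w : F) : acc d0 u v ->
    (if is_box (val d0) == sign (val d0) then le v w else le w v) -> acc d0 u w.
  by move=> uv vw; apply: accP; exists u, v; split=> //; case: ifP => _; apply: frame_refl.
case: d d' dd' dxy ncl => [[] p] [[] p'] //= _ dxy ncl.
- move=> /holds_quasi_ineq0 /(_ x) h; apply: h dxy yy; split=> v /= dv; last by apply.
  by have [vy|] := pselect (le v y); [right=> d'v; apply: ncl d'v xx vy|left].
- move=> /holds_quasi_ineq1 h; apply: (h _ x xx _ dxy yy) => u [/= xu [v [vy uv]]] w uw wy.
  by apply: (ncl u y) => //; [apply: accr uw _|apply: accr uv _; apply: contrapT].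
- move=> /holds_quasi_ineq0 /(_ x) h; apply: h dxy yy; split=> v /= dv.
    by move=> [yv d'v]; apply: ncl d'v xx yv.
  by [].
- move=> /holds_quasi_ineq1 h; apply: (h _ x xx _ dxy yy) => u [/= xu [v [vy uv]]] w uw wy.
  by apply: (ncl u y) => //; [apply: accr uw _|apply: accr uv _].
- move=> /holds_quasi_ineq1 h; apply: (h _ x _ xx); last by exists y.
  move=> u /= [v [yv uv]]; have [ux|] := pselect (le u x); last by right.
  left=> w uw yw.
  by apply: (ncl u y) => //; [apply: accr uv _|apply: accr uw _].
- move=> /holds_quasi_ineq0 /(_ x)[]; first by exists y.
    by move=> [v [/= [yv d'v] dv]]; apply: ncl dv d'v xx yv.
  by move=> [v [/= nd'v d'v]].
- move=> /holds_quasi_ineq1 h; apply: (h _ x _ xx); last by exists y; split=> // /(_ yy).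
  move=> u /= [v [/contrapT yv uv]]; have [ux|] := pselect (le u x); last by right.
  left=> w uw yw.
  by apply: (ncl u y) => //; [apply: accr uv _|apply: accr uw _].
- move=> /holds_quasi_ineq0 /(_ x)[]; first by exists y; split=> // /(_ yy).
    move=> [v [/= /not_orP[/contrapT vy /contrapT d'v] dv]]; exact: ncl dv d'v xx vy.
  by move=> [v [/= nd'v d'v]].
Qed.

End InterpolationFormulas.

(** * Definability when the signs are distinct *)

Lemma definable_by_interpolation (L : {set modal_symbol}) (C : set (qf_formula L))
    (ax : symbol_in L -> symbol_in L -> qf_formula L) :
  {in L &, injective sign} -> (forall d d', C (ax d d')) ->
  (forall F d d', sign (val d) != sign (val d') ->
     interpolates F d d' <-> satisfies (complex_algebra F) (ax d d')) ->
  definable_by (@unimodal L) C.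
Proof.
move=> inj Cax axP.
exists [set f | exists d d', sign (val d) != sign (val d') /\ f = ax d d'].
  by move=> f [d [d' [_ ->]]]; apply: Cax.
move=> F; split=> [uF f [d [d' [dd' ->]]]|h].
  by apply/axP => //; apply: unimodal_interpolates.
apply: interpolates_unimodal => // d d' dd'; apply/axP => //.
by apply: h; exists d, d'.
Qed.

Lemma definable_by_quasi (L : {set modal_symbol}) : {in L &, injective sign} ->
  definable_by (@unimodal L) (@lattice_quasiequation L).
Proof.
move=> inj; apply: (definable_by_interpolation inj
  (@lattice_quasiequation_interpolation L)) => F d d' dd'.
split; last exact: quasi_interpolates.
by move=> /(interpolates_eqn dd'); apply: eqn_quasi.
Qed.

Lemma definable_by_eqn (L : {set modal_symbol}) : {in L &, injective sign} ->
  definable_by (@unimodal L) (@biheyting_equation L).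
Proof.
move=> inj; apply: (definable_by_interpolation inj (ax := @interpolation_eqn L)).
  by move=> d d'; eexists; eexists; reflexivity.
move=> F d d' dd'; split; first exact: interpolates_eqn.
by move=> /(eqn_quasi dd'); apply: quasi_interpolates.
Qed.

Lemma definable_byS (L : {set modal_symbol}) (K : modal_frame L -> Prop) C C' :
  C `<=` C' -> definable_by K C -> definable_by K C'.
Proof. by move=> CC' [G GC GK]; exists G => // f /GC /CC'. Qed.

(** Universal sentences pass to subalgebras: by injectivity an equation holds in [A] iff it holds in
    [B] under the image valuation. *)
Lemma satisfies_embedding (L : {set modal_symbol}) (A B : algebra L) (h : A -> B) :
  injective h ->
  (forall a b, h (meet a b) = meet (h a) (h b)) ->
  (forall a b, h (join a b) = join (h a) (h b)) ->
  h (top A) = top B -> h (bot A) = bot B ->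
  (forall a b, h (imp a b) = imp (h a) (h b)) ->
  (forall a b, h (coimp a b) = coimp (h a) (h b)) ->
  (forall d a, h (modal d a) = modal d (h a)) ->
  forall f, satisfies B f -> satisfies A f.
Proof.
move=> hI hM hJ hT hB hi hc hm f Bf e.
have ev t : h (eval e t) = eval (h \o e) t.
  elim: t => //= [s <- t <-|s <- t <-|s <- t <-|s <- t <-|d t <-];
    [exact: hM|exact: hJ|exact: hi|exact: hc|exact: hm].
suff hf : holds e f <-> holds (h \o e) f by apply/hf/Bf.
elim: f {Bf} => //= [s t|f <-|f IHf g IHg|f IHf g IHg|f IHf g IHg] //.
- by rewrite -!ev; split=> [->//|/hI].
- by rewrite IHf IHg.
- by rewrite IHf IHg.
- by rewrite IHf IHg.
Qed.

(** * Dyadic rationals *)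

Local Open Scope ring_scope.

Definition dyadic (x : rat) : Prop := exists k (n : int), x * 2 ^+ k = n%:~R.

Lemma dyadicB x y : dyadic x -> dyadic y -> dyadic (x - y).
Proof.
move=> [k [n xn]] [l [m ym]]; exists (k + l)%N, (n * 2 ^+ l - m * 2 ^+ k).
rewrite mulrBl rmorphB !rmorphM !rmorphXn /= -xn -ym exprD; congr (_ - _).
  by rewrite mulrA.
by rewrite mulrA mulrAC.
Qed.

Lemma dyadic_third : ~ dyadic 3^-1.
Proof.
move=> [k [n]] /(congr1 ( *%R 3)); rewrite mulrA divff // mul1r => e.
have {}e : 2 ^+ k = 3 * n :> int.
  by apply/eqP; rewrite -(eqr_int rat) rmorphM rmorphXn /= e.
have : (3 %| `|2 ^+ k : int|)%N by rewrite e abszM dvdn_mulr.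
by rewrite abszX Euclid_dvdX.
Qed.

Lemma dyadic_dense p q : p < q -> exists2 r, dyadic r & p < r < q.
Proof.
move=> pq; have qp : 0 < q - p by rewrite subr_gt0.
have [k hk] : exists k, 1 < (q - p) * 2 ^+ k.
  exists (Num.bound (q - p)^-1).
  rewrite -ltr_pdivrMl // mulr1.
  apply: lt_trans (archi_boundP _) _; first by rewrite invr_ge0 ltW.
  by rewrite -natrX ltr_nat ltn_expl.
have k0 : 0 < 2 ^+ k :> rat by apply: exprn_gt0.
have [c ck] : exists c, c = 2 ^+ k :> rat by eexists.
rewrite -ck in hk k0.
have h1 := floorD1_gt (p * c); have h2 := floor_le (p * c).
(* The first multiple of [1 / c] beyond [p]; it is below [q] because [1 / c] is less than
   [q - p]. *)
exists ((Num.floor (p * c) + 1)%:~R / c).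
  by exists k, (Num.floor (p * c) + 1); rewrite -ck divfK // gt_eqF.
rewrite ltr_pdivlMr // ltr_pdivrMr //; move: h1 h2 hk; rewrite rmorphD /= mulrBl; lra.
Qed.

(** The translate of the dyadics by 1/3 is dense and contains no dyadic. *)
Lemma nondyadic_dense p q : p < q -> exists2 r, ~ dyadic r & p < r < q.
Proof.
move=> pq; have [|r Dr /andP[pr rq]] := @dyadic_dense (p - 3^-1) (q - 3^-1).
  by rewrite ltrD2r.
exists (r + 3^-1); last by rewrite -ltrBlDr pr -ltrBrDr.
by move=> /dyadicB/(_ Dr); rewrite addrC addKr; apply: dyadic_third.
Qed.

Definition upward_dyadic (B : rat -> Prop) (x : rat) : Prop :=
  exists2 p, dyadic p & p <= x /\ B p.

Lemma upward_box (B : rat -> Prop) u :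
  (forall p q, dyadic p -> dyadic q -> p <= q -> B p -> B q) ->
  upward_dyadic (fun p => forall q, dyadic q ->
    (exists2 r, ~ dyadic r & p <= r <= q) -> B q) u <->
  forall v, (exists2 r, ~ dyadic r & u <= r <= v) -> upward_dyadic B v.
Proof.
move=> uB; split.
  move=> [p Dp [pu hp]] v [r nDr /andP[ur rv]].
  (* The nondyadic [r] differs from [p], so there is room for a nondyadic and then a dyadic point
     between [p] and [v]. *)
  have pv : p < v.
    apply: lt_le_trans rv; rewrite lt_neqAle (le_trans pu ur) andbT.
    by apply/eqP => pr; apply: nDr; rewrite -pr.
  have [r' nDr' /andP[pr' r'v]] := nondyadic_dense pv.
  have [q Dq /andP[r'q qv]] := dyadic_dense r'v.
  exists q => //; split; [exact: ltW|apply: hp => //].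
  by exists r' => //; rewrite !ltW.
move=> h; have [Du|nDu] := pselect (dyadic u).
  exists u => //; split=> // q Dq /h[p Dp [pq Bp]]; exact: uB Bp.
(* A nondyadic [u] is related to itself, so [h] applies at [u]. *)
have [|p Dp [pu Bp]] := h u; first by exists u; rewrite ?lexx.
exists p => //; split=> // q Dq [r _ /andP[pr rq]].
by apply: uB Bp => //; apply: le_trans rq.
Qed.

Lemma upward_diamond (B : rat -> Prop) u :
  upward_dyadic (fun p => exists q, [/\ dyadic q, B q &
    exists2 r, ~ dyadic r & q <= r <= p]) u <->
  exists v, upward_dyadic B v /\ exists2 r, ~ dyadic r & v <= r <= u.
Proof.
split=> [[p Dp [pu [q [Dq Bq [r nDr /andP[qr rp]]]]]]|].
  exists q; split; first by exists q.
  by exists r => //; rewrite qr (le_trans rp).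
move=> [v [[p Dp [pv Bp]] [r nDr /andP[vr ru]]]].
have pr : p < r.
  rewrite lt_neqAle (le_trans pv vr) andbT.
  by apply/eqP => pr; apply: nDr; rewrite -pr.
have [r' nDr' /andP[pr' r'r]] := nondyadic_dense pr.
(* [q] is a dyadic point below [u], still separated from [p] by the nondyadic [r']. *)
have [q Dq /andP[r'q qr]] := dyadic_dense r'r.
exists q => //; split; first by rewrite (le_trans (ltW qr)).
by exists p; split=> //; exists r' => //; rewrite !ltW.
Qed.

(** * Uniform description of the four operators *)

Definition polarize (b : bool) (P : Prop) : Prop := if b then P else ~ P.

Lemma polarizeK b P : polarize b (polarize b P) <-> P.
Proof. by case: b => //=; split=> [/contrapT|?]. Qed.

Lemma polarize_iff b P Q : (P <-> Q) -> (polarize b P <-> polarize b Q).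
Proof. by move=> PQ; case: b; rewrite /polarize PQ. Qed.

Lemma modal_setE (L : {set modal_symbol}) (F : modal_frame L) (d : symbol_in L)
    (a : set F) u :
  modal_set d a u <->
  if is_box (val d) then forall v, acc d u v -> polarize (sign (val d)) (a v)
  else exists v, polarize (sign (val d)) (a v) /\ acc d u v.
Proof. by case: d => -[]. Qed.

Lemma modal_closure_idem (W : Type) (le : relation W) d (R : relation W) :
  Relation_Definitions.order W le ->
  is_modal_relation le d (modal_closure le d R).
Proof.
case=> _ tr _ x y /modal_closureP[x' [y' [xx' /modal_closureP[x2 [y2 [x'x2 R2 y2y']]] y'y]]].
apply/modal_closureP; exists x2, y2; split=> //.
  by move: xx' x'x2; case: ifP => _ h1 h2; [apply: tr h2|apply: tr h1].
by move: y2y' y'y; case: ifP => _ h1 h2; [apply: tr h2|apply: tr h1].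
Qed.

(** * Two lines of rationals *)

Section Countermodel.
Variables (L : {set modal_symbol}) (s : bool).

(** The first coordinate names the line, [false] for the first one; [u.1 ==> s] fails only on the
    second line when [s] is -. *)
Definition line_le (u v : bool * rat) : Prop :=
  u.1 = v.1 /\ (if u.1 ==> s then u.2 <= v.2 else v.2 <= u.2).

Lemma line_le_order : Relation_Definitions.order (bool * rat) line_le.
Proof.
split.
- by move=> u; split=> //; case: ifP.
- move=> u v w [uv1 uv2] [vw1 vw2]; split; first by rewrite uv1.
  rewrite -uv1 in vw2; move: uv2 vw2; case: ifP => _ h1 h2;
    [exact: le_trans h2|exact: le_trans h1].
- move=> [i p] [j q] [/= -> h1] [_ h2]; congr (_, _); apply/le_anti.
  by move: h1 h2 => /=; case: ifP => _ -> ->.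
Qed.

Definition nondyadic_diagonal : relation (bool * rat) :=
  fun u v => [/\ u.1 = false, v.1 = true, u.2 = v.2 & ~ dyadic u.2].

Definition line_acc (d : modal_symbol) : relation (bool * rat) :=
  modal_closure line_le d nondyadic_diagonal.

(** Reversing the second line when [s] is - flips its inequality, so in the order of [rat] only
    agreement of [sign d] with [s] matters. *)
Lemma line_accP d u v : line_acc d u v <->
  [/\ u.1 = false, v.1 = true & exists2 r, ~ dyadic r &
      (if is_box d then u.2 <= r else r <= u.2) /\
      (if is_box d == (sign d == s) then r <= v.2 else v.2 <= r)].
Proof.
rewrite /line_acc modal_closureP; split.
  move=> [[i p] [[j q] [h1 [/= Ei Ej Epq nDp] h2]]]; subst i j q.
  have [u1 h1'] : u.1 = false /\ (if is_box d then u.2 <= p else p <= u.2).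
    by move: h1; case: (is_box d) => -[/= E]; rewrite E.
  have [v1 h2'] : v.1 = true /\
      (if is_box d == (sign d == s) then p <= v.2 else v.2 <= p).
    move: h2; rewrite /line_le; case: v => j q.
    by case: (is_box d) (sign d) s => [] [] [] /= [E]; subst j.
  by split=> //; exists p.
case: u v => [i p] [j q] [/= -> -> [r nDr [h1 h2]]].
exists (false, r), (true, r); split=> //.
  by case: (is_box d) h1.
by move: h2; rewrite /line_le; case: (is_box d) (sign d) s => [] [] [].
Qed.

Lemma line_acc_box d u v : is_box d -> sign d = s -> line_acc d u v <->
  [/\ u.1 = false, v.1 = true & exists2 r, ~ dyadic r & u.2 <= r <= v.2].
Proof.
move=> bd sd; rewrite line_accP bd sd !eqxx.
by split=> -[-> -> [r nDr rP]]; split=> //; exists r => //;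
  [case: rP => -> ->|apply/andP].
Qed.

Lemma line_acc_diamond d u v : is_box d = false -> sign d = s -> line_acc d u v <->
  [/\ u.1 = false, v.1 = true & exists2 r, ~ dyadic r & v.2 <= r <= u.2].
Proof.
move=> bd sd; rewrite line_accP bd sd !eqxx.
by split=> -[-> -> [r nDr rP]]; split=> //; exists r => //;
  [case: rP => /= -> ->|case/andP: rP].
Qed.

Definition line_frame : modal_frame L :=
  @ModalFrame L (bool * rat) line_le line_le_order (fun d => line_acc (val d))
    (fun d => modal_closure_idem line_le_order).

Lemma unimodal_line_frame : unimodal line_frame.
Proof. by exists nondyadic_diagonal. Qed.

Definition dyadic_point : Type := {u : bool * rat | dyadic u.2}.

Definition dyadic_le (u v : dyadic_point) : Prop := line_le (sval u) (sval v).

Definition dyadic_acc d (u v : dyadic_point) : Prop := line_acc d (sval u) (sval v).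

Lemma dyadic_le_order : Relation_Definitions.order dyadic_point dyadic_le.
Proof.
case: line_le_order => re tr an; split.
- by move=> u; apply: re.
- by move=> u v w; apply: tr.
- by move=> [u Du] [v Dv] h1 h2; apply: eq_exist; apply: an.
Qed.

Lemma dyadic_acc_modal d : is_modal_relation dyadic_le d (dyadic_acc d).
Proof.
move=> x y /modal_closureP[x' [y' [h1 h2 h3]]].
apply: (modal_closure_idem line_le_order); apply/modal_closureP.
by exists (sval x'), (sval y').
Qed.

Definition dyadic_frame : modal_frame L :=
  @ModalFrame L dyadic_point dyadic_le dyadic_le_order (fun d => dyadic_acc (val d))
    (fun d => @dyadic_acc_modal (val d)).

Lemma dyadic_frame_not_unimodal (d d' : symbol_in L) :
  is_box (val d) -> is_box (val d') = false -> sign (val d) = s -> sign (val d') = s ->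
  ~ unimodal dyadic_frame.
Proof.
move=> bd bd' sd sd' uF; have h := @unimodal_interpolates _ _ d d' uF.
have D0 : dyadic 0 by exists 0%N, 0; rewrite mul0r.
have D1 : dyadic 1 by exists 0%N, 1; rewrite mul1r.
pose x : dyadic_frame := exist _ (false, 0) D0.
pose y : dyadic_frame := exist _ (true, 1) D1.
have /h : acc d x y.
  apply/(line_acc_box _ _ bd sd); split=> //=.
  by have [r nDr /andP[r0 r1]] := @nondyadic_dense 0 1 isT; exists r; rewrite ?ltW.
move=> /modal_closureP[[u Du] [[v Dv] [_ [/(line_acc_box _ _ bd sd)[/= _ _ [r nDr]]]]]].
(* A pair in both relations gives [u <= r <= v <= r' <= u], which makes the nondyadic [r] equal to
   the dyadic [u]. *)
move=> /andP[ur rv] /(line_acc_diamond _ _ bd' sd')[/= _ _ [r' _ /andP[vr' r'u]]] _.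
apply: nDr; suff -> : r = u.2 by [].
by apply/le_anti; rewrite ur (le_trans rv (le_trans vr' r'u)).
Qed.

(** * Extending sets of dyadic points to the two lines *)

Definition slice (a : set dyadic_frame) (i : bool) (q : rat) : Prop :=
  exists Dq : dyadic q, polarize (i ==> s) (a (exist _ (i, q) Dq)).

(* Upward closure is taken in the order of [rat] on both lines; on a reversed line
   it therefore applies to the complement.  The closure in the order of the frame
   would not commute with the operators of sign [s]. *)
Definition extension (a : set dyadic_frame) : set line_frame :=
  fun w => polarize (w.1 ==> s) (upward_dyadic (slice a w.1) w.2).

Implicit Types a b : set dyadic_frame.

Lemma slice_up a i p q : is_upset a -> dyadic q -> p <= q -> slice a i p -> slice a i q.
Proof.
move=> ua Dq pq [Dp h]; exists Dq; move: h; rewrite /polarize.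
case: ifP => Ei h; first by apply: ua h; split=> //=; rewrite Ei.
by move=> h'; apply: h; apply: ua h'; split=> //=; rewrite Ei.
Qed.

(** On a reversed line the negations in [slice] and [extension] cancel. *)
Lemma extension_mono a b w :
  (forall p : dyadic_frame, (sval p).1 = w.1 -> a p -> b p) ->
  extension a w -> extension b w.
Proof.
move=> ab; rewrite /extension /slice /polarize; case: (w.1 ==> s).
  by move=> [p Dp [pw [Dq h]]]; exists p => //; split=> //; exists Dq; apply: ab.
move=> h [p Dp [pw [Dq nb]]]; apply: h; exists p => //; split=> //.
by exists Dq => /ab h; apply: nb; apply: h.
Qed.

Lemma extension_sval a (p : dyadic_frame) : is_upset a -> extension a (sval p) <-> a p.
Proof.
case: p => [[i q] Dq] ua; rewrite /extension /=.
rewrite -[X in _ <-> X](polarizeK (i ==> s)); apply: polarize_iff; split.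
  move=> [r Dr [rq /(slice_up ua Dq rq)[Dq']]].
  by have -> : Dq' = Dq by apply: Prop_irrelevance.
by move=> h; exists q => //; split=> //; exists Dq.
Qed.

Lemma extension_upset a : is_upset (extension a).
Proof.
move=> u v [uv1 uv2]; rewrite /extension -uv1; move: uv2; rewrite /polarize.
case: ifP => _ uv.
  by move=> [p Dp [pu h]]; exists p => //; split=> //; apply: le_trans uv.
by move=> nh [p Dp [pu h]]; apply: nh; exists p => //; split=> //; apply: le_trans uv.
Qed.

Lemma extensionT w : extension setT w.
Proof.
rewrite /extension /slice /polarize; case: (w.1 ==> s); last by move=> [p Dp [_ [Dq]]]; apply.
have [|p Dp /andP[_ pw]] := @dyadic_dense (w.2 - 1) w.2; first by rewrite gtrBl.
by exists p => //; split; [exact: ltW|exists Dp].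
Qed.

Lemma extension0 w : ~ extension set0 w.
Proof.
rewrite /extension /slice /polarize; case: (w.1 ==> s); first by move=> [p Dp [_ [Dq]]].
have [|p Dp /andP[_ pw]] := @dyadic_dense (w.2 - 1) w.2; first by rewrite gtrBl.
by apply; exists p => //; split; [exact: ltW|exists Dp].
Qed.

Lemma line_le_total (u v : line_frame) : u.1 = v.1 -> le u v \/ le v u.
Proof.
move=> uv; rewrite /= /line_le -uv; case: ifP => _.
  by case: (leP u.2 v.2) => h; [left|right]; split=> //; apply: ltW.
by case: (leP u.2 v.2) => h; [right|left]; split=> //; apply: ltW.
Qed.

(** Together with [witness_sub] this says that the upsets of a line form a chain, with a witness of
    noninclusion at hand. *)
Lemma slice_sub_or a b i :
  (forall p : dyadic_frame, (sval p).1 = i -> a p -> b p) \/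
  exists2 p : dyadic_frame, (sval p).1 = i & a p /\ ~ b p.
Proof.
apply: contrapT => /not_orP[nab]; apply; apply: contrapT => nex; apply: nab.
by move=> p pi ap; apply: contrapT => nbp; apply: nex; exists p.
Qed.

Lemma witness_sub a b (p q : dyadic_frame) : is_upset a -> is_upset b ->
  (sval q).1 = (sval p).1 -> a p -> ~ b p -> b q -> a q.
Proof.
move=> ua ub qp ap nbp bq; have [/ub/(_ bq)//|pq] := line_le_total qp.
exact: ua pq ap.
Qed.

Lemma extensionI a b : is_upset a -> is_upset b ->
  extension (a `&` b) = extension a `&` extension b.
Proof.
move=> ua ub; apply/seteqP; split=> [w h|w [ha hb]].
  by split; apply: extension_mono h => p _ [].
have [ab|[p pw [ap nbp]]] := slice_sub_or a b w.1.
  by apply: extension_mono ha => p pw ap; split=> //; apply: ab.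
apply: extension_mono hb => q qw bq; split=> //.
by apply: witness_sub ap nbp bq => //; rewrite qw.
Qed.

Lemma extensionU a b : is_upset a -> is_upset b ->
  extension (a `|` b) = extension a `|` extension b.
Proof.
move=> ua ub; apply/seteqP; split=> [w h|w [h|h]]; last 2 first.
- by apply: extension_mono h => p; left.
- by apply: extension_mono h => p; right.
have [ab|[p pw [ap nbp]]] := slice_sub_or a b w.1.
  by right; apply: extension_mono h => q qw [/ab|//]; apply.
left; apply: extension_mono h => q qw [//|bq].
by apply: witness_sub ap nbp bq => //; rewrite qw.
Qed.

(** On one line the implication is everything if [a] lies within [b], and [b] otherwise. *)
Lemma extension_imp a b : is_upset a -> is_upset b ->
  extension (imp_set a b) = imp_set (extension a) (extension b).
Proof.
move=> ua ub; apply/seteqP; split=> w h.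
  have [ab|[p pw [ap nbp]]] := slice_sub_or a b w.1.
    by move=> v [wv _]; apply: extension_mono; rewrite -wv.
  move=> v wv _; apply: extension_upset wv _; apply: extension_mono h => q qw h.
  have [qp|pq] := @line_le_total (sval q) (sval p) (etrans qw (esym pw)).
    by case: nbp; apply: h.
  by apply: h; [exact: frame_refl|exact: ua pq ap].
have [ab|[p pw [ap nbp]]] := slice_sub_or a b w.1.
  apply: extension_mono (extensionT w) => q qw _ v qv; apply: ab.
  by case: qv => <-.
suff hb : extension b w by apply: extension_mono hb => q _ bq v qv _; apply: ub qv bq.
have [wp|pw'] := @line_le_total w (sval p) (esym pw).
  by case: nbp; apply/(extension_sval _ ub)/h => //; apply/(extension_sval _ ua).
apply: h; first exact: (@frame_refl _ line_frame).
by apply: extension_upset pw' _; apply/(extension_sval _ ua).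
Qed.

(** On one line the co-implication is empty if [a] lies within [b], and [a] otherwise. *)
Lemma extension_coimp a b : is_upset a -> is_upset b ->
  extension (coimp_set a b) = coimp_set (extension a) (extension b).
Proof.
move=> ua ub; apply/seteqP; split=> w h.
  have [ab|[p pw [ap nbp]]] := slice_sub_or a b w.1.
    case: (@extension0 w); apply: extension_mono h => q qw [v [vq av]] /=.
    by apply; apply: ab => //; case: vq => ->.
  have ha : extension a w by apply: extension_mono h => q _ [v [vq av _]]; apply: ua vq av.
  have [wp|pw'] := @line_le_total w (sval p) (esym pw).
    exists w; split=> //; first exact: (@frame_refl _ line_frame).
    by move=> /(extension_upset wp)/(extension_sval _ ub).
  exists (sval p); split=> //; first exact/(extension_sval _ ua).
  by move=> /(extension_sval _ ub).
case: h => v [vw av nbv].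
have [ab|[p pw [ap nbp]]] := slice_sub_or a b v.1.
  by case: nbv; apply: extension_mono av.
have := extension_upset vw av; apply: extension_mono => q qw aq.
have qv : (sval q).1 = v.1 by case: vw => ->.
have [qp|pq] := @line_le_total (sval q) (sval p) (etrans qv (esym pw)).
  exists q; split=> //; first exact: frame_refl.
  by move=> bq; apply: nbp; apply: ub qp bq.
by exists p.
Qed.

Lemma extension_const a (w : line_frame) (P : Prop) :
  (forall p : dyadic_frame, (sval p).1 = w.1 -> (a p <-> P)) -> (extension a w <-> P).
Proof.
move=> aP; split=> h.
  apply: contrapT => nP; apply: (@extension0 w).
  by apply: extension_mono h => p pw /(aP p pw)/nP.
by apply: extension_mono (extensionT w) => p pw _; apply/(aP p pw).
Qed.

(** This serves the operators whose sign is not [s]: they quantify over the whole second line, where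
    nondyadic points change nothing. *)
Lemma extension_all (b : bool) a i : is_upset a ->
  (forall p : dyadic_frame, (sval p).1 = i -> polarize b (a p)) <->
  (forall w : line_frame, w.1 = i -> polarize b (extension a w)).
Proof.
move=> ua; split=> h.
  move=> w wi; case: b h => h.
    by apply/(extension_const (P := True)) => // p; rewrite wi => /h.
  by move/(extension_const (P := False)); apply=> p; rewrite wi => /h.
move=> p /h; case: b {h} => /=; first by move=> /(extension_sval _ ua).
by move=> h /(extension_sval _ ua).
Qed.

Lemma extension_ex (b : bool) a i : is_upset a ->
  (exists p : dyadic_frame, (sval p).1 = i /\ polarize b (a p)) <->
  (exists w : line_frame, w.1 = i /\ polarize b (extension a w)).
Proof.
have polN P : ~ polarize (~~ b) P <-> polarize b P.
  by case: b => //=; split=> [/contrapT|?].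
move=> ua; have h := extension_all (~~ b) i ua.
split; apply: contraPP => nex [x [xi]]; rewrite -polN; apply.
  apply: (h.2 _ _ xi) => w wi; apply: contrapT => /polN nw.
  by apply: nex; exists w.
apply: (h.1 _ _ xi) => w wi; apply: contrapT => /polN nw.
by apply: nex; exists w.
Qed.

(** When the signs differ, both inequalities bound [r] from the same side, so a large or small
    enough nondyadic [r] fits any two points. *)
Lemma line_acc_total d (u v : line_frame) : sign d != s ->
  u.1 = false -> v.1 = true -> line_acc d u v.
Proof.
move=> /negbTE sd u0 v1; apply/line_accP; split=> //; rewrite sd.
have [|r nDr /andP[h1 h2]] := @nondyadic_dense (Num.max u.2 v.2) (Num.max u.2 v.2 + 1).
  by rewrite ltrDl.
have [|r' nDr' /andP[h1' h2']] := @nondyadic_dense (Num.min u.2 v.2 - 1) (Num.min u.2 v.2).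
  by rewrite gtrBl.
move: h1 h2'; rewrite gt_max lt_min => /andP[? ?] /andP[? ?].
by case: (is_box d) => /=; [exists r|exists r'] => //; split; apply: ltW.
Qed.

Lemma upward_dyadic_iff (B B' : rat -> Prop) u :
  (forall p, dyadic p -> (B p <-> B' p)) -> upward_dyadic B u <-> upward_dyadic B' u.
Proof.
by move=> BB'; split=> -[p Dp [pu /(BB' p Dp) h]]; exists p.
Qed.

Lemma extension_modal (d : symbol_in L) a : is_upset a ->
  extension (modal_set d a) = modal_set d (extension a).
Proof.
move=> ua; apply/funext => -[[] u]; apply/propext.
  (* Points of the second line have no successors, so the operator is constant there. *)
  apply: (@extension_const _ (true, u)) => p p1; rewrite !modal_setE.
  case: ifP => _.
    by split=> _ v /line_accP[] //; rewrite p1.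
  by split=> -[v [_ /line_accP[]]] //; rewrite p1.
have [sd|sd] := eqVneq (sign (val d)) s; last first.
  apply: (@extension_const _ (false, u)) => p p0; rewrite !modal_setE.
  case: ifP => _.
    split=> h v.
      move=> /line_accP[_ v1 _]; apply: (extension_all _ _ ua).1 v1 => q q1.
      by apply: h; apply: line_acc_total.
    move=> /line_accP[_ v1 _]; apply: (extension_all _ _ ua).2 v1 => q q1.
    by apply: h; apply: line_acc_total.
  split=> -[v [hv /line_accP[_ v1 _]]].
    have [|w [w1 hw]] := (extension_ex (sign (val d)) true ua).1; first by exists v.
    by exists w; split=> //; apply: line_acc_total.
  have [|w [w1 hw]] := (extension_ex (sign (val d)) true ua).2; first by exists v.
  by exists w; split=> //; apply: line_acc_total.
(* The negation of an operator of sign [s] cancels the one in [extension] on the second line,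
   leaving a statement about [rat] alone. *)
have extE v : polarize s (extension a (true, v)) <-> upward_dyadic (slice a true) v.
  by rewrite polarizeK.
rewrite modal_setE sd; have [bd|/negbTE bd] := boolP (is_box (val d)).
  have accE := fun u v => line_acc_box u v bd sd.
  apply: (iff_trans _ (iff_trans (upward_box u _) _)); last first.
  - split=> h v; last by move=> hv; apply/extE/h/accE.
    by case: v => j v /accE[/= _ -> hv]; apply/extE/h.
  - by move=> p q Dp Dq pq; apply: slice_up.
  apply: upward_dyadic_iff => p Dp; split.
    move=> [Dp' /modal_setE]; rewrite bd sd => h q Dq hq.
    by exists Dq; apply: h; apply/accE.
  move=> h; exists Dp; apply/modal_setE; rewrite bd sd => -[[j q] Dq].
  move=> /accE[/= _ Ej /(h q Dq)[Dq' hq]]; subst j.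
  by rewrite (Prop_irrelevance Dq Dq').
have accE := fun u v => line_acc_diamond u v bd sd.
apply: (iff_trans _ (iff_trans (upward_diamond (slice a true) u) _)); last first.
  split=> -[v].
    by move=> [hv hr]; exists (true, v); split; [apply/extE|apply/accE].
  by case: v => j v [hv /accE[/= _ Ej hr]]; subst j; exists v; split=> //; apply/extE.
apply: upward_dyadic_iff => p Dp; split.
  move=> [Dp' /modal_setE]; rewrite bd sd => -[[[j q] Dq] [hq /accE[/= _ Ej hr]]].
  by subst j; exists q; split=> //; exists Dq.
move=> [q [Dq [Dq' hq] hr]]; exists Dp; apply/modal_setE.
by rewrite bd sd; exists (exist _ (true, q) Dq'); split=> //; apply/accE.
Qed.

Definition extension_upset_map (a : upset dyadic_frame) : upset line_frame :=
  exist _ (extension (sval a)) (@extension_upset (sval a)).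

Lemma satisfies_dyadic_frame f :
  satisfies (complex_algebra line_frame) f -> satisfies (complex_algebra dyadic_frame) f.
Proof.
apply: (@satisfies_embedding _ (complex_algebra dyadic_frame) (complex_algebra line_frame)
  extension_upset_map).
- move=> [a ua] [b ub] /(congr1 sval) /= ab; apply: upset_inj; apply/seteqP.
  by split=> p /=; rewrite -(extension_sval _ ua) -(extension_sval _ ub) ab.
- by move=> [a ua] [b ub]; apply: upset_inj; apply: extensionI.
- by move=> [a ua] [b ub]; apply: upset_inj; apply: extensionU.
- by apply: upset_inj; apply/seteqP; split=> // w _; apply: extensionT.
- by apply: upset_inj; apply/seteqP; split=> // w /extension0.
- by move=> [a ua] [b ub]; apply: upset_inj; apply: extension_imp.
- by move=> [a ua] [b ub]; apply: upset_inj; apply: extension_coimp.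
- by move=> d [a ua]; apply: upset_inj; apply: extension_modal.
Qed.

End Countermodel.

(** * Necessity of distinct signs, and the equivalence *)

Lemma definable_sign_injective (L : {set modal_symbol}) :
  definable_by (@unimodal L) (@biheyting_universal L) -> {in L &, injective sign}.
Proof.
move=> [G _ GP] d d' dL d'L ss; apply: contrapT => dd'.
have box_diam (e e' : symbol_in L) :
    is_box (val e) -> is_box (val e') = false -> sign (val e) = sign (val e') -> False.
  (* The dyadic frame inherits the defining sentences from the unimodal line frame, so it would be
     unimodal too. *)
  move=> be be' se; apply: (dyadic_frame_not_unimodal (s := sign (val e')) be be') => //.
  apply/GP => f Gf; apply: satisfies_dyadic_frame.
  exact: (GP _).1 (unimodal_line_frame L _) f Gf.
case Ed: (is_box d); case Ed': (is_box d').
- by apply: dd'; case: d d' ss Ed Ed' {dL d'L} => [] [].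
- by apply: (box_diam (exist _ d dL) (exist _ d' d'L)); rewrite //=.
- by apply: (box_diam (exist _ d' d'L) (exist _ d dL)); rewrite //=.
- by apply: dd'; case: d d' ss Ed Ed' {dL d'L} => [] [].
Qed.

Local Close Scope classical_set_scope.
Local Close Scope ring_scope.

Theorem mainTheorem8 (L : {set modal_symbol}) :
  [<-> definable_by (@unimodal L) (@lattice_quasiequation L);
       definable_by (@unimodal L) (@lattice_universal L);
       definable_by (@unimodal L) (@biheyting_equation L);
       definable_by (@unimodal L) (@biheyting_universal L);
       [/\ #|L| <= 2, L <> [set BoxP; DiamP] & L <> [set BoxM; DiamM]]].
Proof.
tfae.
- by apply: definable_byS => f [].
(* Equations are obtained through distinctness of signs, which any universal definition forces. *)
- move=> h; apply: definable_by_eqn; apply: definable_sign_injective.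
  exact: definable_byS h.
- exact: definable_byS.
- by move=> /definable_sign_injective/sign_injectiveP.
- by move=> /sign_injectiveP; apply: definable_by_quasi.
Qed.
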